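(* For $x_1,x_2\in E$ and $t\in[\alpha_{\mathbf{u}}(x_1,x_2),\beta_{\mathbf{u}}(x_1,x_2)]$ let $$\gamma_{\mathbf{u}}(x_1,x_2,t)=\begin{cases}x_1\vee(x_2+t\mathbf{u}) & \text{if }\alpha_{\mathbf{u}}(x_1,x_2)\le t\le 0,\\ (x_1-t\mathbf{u})\vee x_2 & \text{if }0\le t\le\beta_{\mathbf{u}}(x_1,x_2).\end{cases}$$ Then for all $x_1,x_2\in E$ and all $t_1,t_2\in[\alpha_{\mathbf{u}}(x_1,x_2),\beta_{\mathbf{u}}(x_1,x_2)]$, $$\mathsf{D}_{\mathbf{hu}}\big(\gamma_{\mathbf{u}}(x_1,x_2,t_1),\gamma_{\mathbf{u}}(x_1,x_2,t_2)\big)=|t_1-t_2|.$$ In other words, the family $\Gamma_{\mathbf{u}}=\big(\gamma_{\mathbf{u}}(x_1,x_2,\cdot),[\alpha_{\mathbf{u}}(x_1,x_2),\beta_{\mathbf{u}}(x_1,x_2)]\big)_{(x_1,x_2)\in E\times E}$ is a geodesic structure on $(E,\mathsf{D}_{\mathbf{hu}})$ for which the geodesics are precisely the max-plus segments, i.e. the image of $\gamma_{\mathbf{u}}(x_1,x_2,\cdot)$ is $[\![x_1,x_2]\!]$ for all $x_1,x_2\in E$.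
   Context: $E\neq\{0\}$ is an Archimedean Riesz space (real vector lattice; Archimedean means that if $ny\leqslant x$ for all $n\in\mathbb{N}$ then $y\leqslant 0$), and $\mathbf{u}\in E_+$ is a unit: for every $x\in E_+$ there is $n\in\mathbb{N}$ with $x\leqslant n\mathbf{u}$. For $x\in E$ let $\mathbf{p}_{\mathbf{u}}(x)=\inf\{t\in\mathbb{R}:x\leqslant t\mathbf{u}\}$ and $\mathbf{q}_{\mathbf{u}}(x)=\sup\{t\in\mathbb{R}:t\mathbf{u}\leqslant x\}$ (real numbers). The max-plus distance is the metric $\mathsf{D}_{\mathbf{hu}}(x,y)=\max\{0,\mathbf{p}_{\mathbf{u}}(x-y)\}+\max\{0,\mathbf{p}_{\mathbf{u}}(y-x)\}$ on $E$. Put $\alpha_{\mathbf{u}}(x_1,x_2)=\min\{0,\mathbf{q}_{\mathbf{u}}(x_1-x_2)\}$ and $\beta_{\mathbf{u}}(x_1,x_2)=\max\{0,\mathbf{p}_{\mathbf{u}}(x_1-x_2)\}$. The max-plus segment of $x_1,x_2$ is $[\![x_1,x_2]\!]=\{x_1\vee(x_2+t\mathbf{u}):t\le0\}\cup\{(x_1+t\mathbf{u})\vee x_2:t\le 0\}$. In a metric space $(X,D)$, a parametrized geodesic from $x_1$ to $x_2$ is a map $\theta:[a,b]\to X$ with $\theta(a)=x_1$, $\theta(b)=x_2$ and $D(\theta(s),\theta(t))=|s-t|$ for all $s,t\in[a,b]$; its image is the associated geodesic. A geodesic structure on $(X,D)$ is a family assigning to each $(x_1,x_2)\in X\times X$ a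 parametrized geodesic from $x_1$ to $x_2$. *)

(* Defs.v *)
From HB Require Import structures.
From mathcomp Require Import all_boot all_order all_algebra.
From mathcomp Require Import all_classical all_reals.
From mathcomp Require Import topology.

Set Implicit Arguments.
Unset Strict Implicit.
Unset Printing Implicit Defensive.

Import Order.TTheory GRing.Theory Num.Theory.

Local Open Scope classical_set_scope.
Local Open Scope ring_scope.

(* The library has no structure joining [latticeType] with additive groups, and
   declaring one on top of its existing hierarchy is rejected by HB; the lattice
   operations are therefore fields here. [riesz_latticeType] recovers the
   library's lattice structure. *)
HB.mixin Record POrderedLmodule_isRiesz (R : numDomainType) E
    & Num.POrderedZmodule E & GRing.Lmodule R E := {
  rmeet : E -> E -> E ;
  rjoin : E -> E -> E ;
  riesz_lexI : forall x y z : E, (x <= rmeet y z) = (x <= y) && (x <= z) ;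
  riesz_leUx : forall x y z : E, (rjoin x y <= z) = (x <= z) && (y <= z) ;
  riesz_leD2r : forall z x y : E, x <= y -> x + z <= y + z ;
  riesz_scale_ge0 : forall (a : R) (x : E), 0 <= a -> 0 <= x -> 0 <= a *: x
}.

#[short(type="rieszType")]
HB.structure Definition Riesz (R : numDomainType) :=
  { E of Num.POrderedZmodule E & GRing.Lmodule R E
       & POrderedLmodule_isRiesz R E }.

Section RieszLattice.
Context {R : numDomainType} {E : rieszType R}.

Definition riesz_latticeType : latticeType ring_display :=
  HB.pack (Riesz.sort E)
    (Order.POrder_isMeetSemilattice.Build ring_display E (@riesz_lexI R E))
    (Order.POrder_isJoinSemilattice.Build ring_display E (@riesz_leUx R E)).

Lemma rmeetE (x y : E) : rmeet x y = @Order.meet _ riesz_latticeType x y :> E.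
Proof. by []. Qed.

Lemma rjoinE (x y : E) : rjoin x y = @Order.join _ riesz_latticeType x y :> E.
Proof. by []. Qed.

End RieszLattice.

Definition riesz_archimedean (R : numDomainType) (E : rieszType R) : Prop :=
  forall x y : E, (forall n : nat, y *+ n <= x) -> y <= 0.

Definition order_unit (R : numDomainType) (E : rieszType R) (u : E) : Prop :=
  0 <= u /\ forall x : E, 0 <= x -> exists n : nat, x <= u *+ n.

Section MaxPlus.
Context {R : realType} {E : rieszType R}.
Implicit Types (u x y : E) (t : R).

(* [inf] and [sup] are total; when [u] is an order unit of an Archimedean
   [E <> {0}] both sets are nonempty and suitably bounded, so these are the
   genuine infimum and supremum. *)
Definition pu u x : R := inf [set t | x <= t *: u].
Definition qu u x : R := sup [set t | t *: u <= x].

Definition Dhu u x y : R :=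
  Num.max 0 (pu u (x - y)) + Num.max 0 (pu u (y - x)).

Definition alphau u x1 x2 : R := Num.min 0 (qu u (x1 - x2)).
Definition betau u x1 x2 : R := Num.max 0 (pu u (x1 - x2)).

(* The two formulas agree at [t = 0]. Values for [t] outside
   [[alphau u x1 x2, betau u x1 x2]] are irrelevant. *)
Definition gammau u x1 x2 t : E :=
  if t <= 0 then rjoin x1 (x2 + t *: u) else rjoin (x1 - t *: u) x2.

Definition max_plus_segment u x1 x2 : set E :=
  [set rjoin x1 (x2 + t *: u) | t in [set t | t <= 0]] `|`
  [set rjoin (x1 + t *: u) x2 | t in [set t | t <= 0]].

End MaxPlus.

Section Geodesics.
Context {R : realType} {X : metricType R}.

(* A map [[a, b] -> X] is represented by a function [R -> X] of which only the
   values on [[a, b]] matter. *)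
Definition parametrized_geodesic (x1 x2 : X) (a b : R) (theta : R -> X) :=
  [/\ a <= b, theta a = x1, theta b = x2 &
      forall s t : R, s \in `[a, b] -> t \in `[a, b] ->
        mdist (theta s) (theta t) = `|s - t| ].

Definition geodesic_structure (a b : X -> X -> R) (theta : X -> X -> R -> X) :=
  forall x1 x2 : X,
    parametrized_geodesic x1 x2 (a x1 x2) (b x1 x2) (theta x1 x2).

End Geodesics.

Section DhuMetric.
Context {R : realType} {E : rieszType R}.
Hypothesis E_neq0 : exists x : E, x <> 0.
Hypothesis archE : riesz_archimedean E.
Context {u : E}.
Hypothesis u_unit : order_unit u.
Implicit Types (x y z : E) (s t : R).

Let leD2r z x y : (x + z <= y + z) = (x <= y).
Proof.
apply/idP/idP => [h|]; last exact: riesz_leD2r.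
by rewrite -(addrK z x) -(addrK z y) riesz_leD2r.
Qed.

Let leD x y x' y' : x <= x' -> y <= y' -> x + y <= x' + y'.
Proof.
move=> xx' yy'; apply: (@le_trans _ _ (x' + y)); first by rewrite leD2r.
by rewrite ![x' + _]addrC leD2r.
Qed.

Let scale_le s t : s <= t -> s *: u <= t *: u.
Proof.
move=> st; rewrite -(leD2r (- (s *: u))) subrr -scalerBl.
by apply: riesz_scale_ge0; [rewrite subr_ge0|case: u_unit].
Qed.

Let scale_leK t x y : 0 < t -> t *: x <= t *: y -> x <= y.
Proof.
move=> t0 h; rewrite -(leD2r (- x)) subrr.
have -> : y - x = t^-1 *: (t *: y - t *: x).
  by rewrite -scalerBr scalerA mulVf ?scale1r// gt_eqF.
apply: riesz_scale_ge0; first by rewrite invr_ge0 ltW.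
by rewrite -(leD2r (t *: x)) add0r subrK.
Qed.

Let le_unit x : exists n : nat, x <= u *+ n.
Proof.
have := lexx (rjoin x 0); rewrite riesz_leUx => /andP[xj /(u_unit.2 _)[n hn]].
by exists n; exact: le_trans hn.
Qed.

Let u_neq0 : ~ (u <= 0).
Proof.
move=> u0; have {}u0 : u = 0 by apply: le_anti; rewrite u0 u_unit.1.
case: E_neq0 => x; apply; apply: le_anti; apply/andP; split.
  by have [n] := le_unit x; rewrite u0 mul0rn.
have [n] := le_unit (- x); rewrite u0 mul0rn => h.
by rewrite -(leD2r (- x)) add0r subrr.
Qed.

Let scaleu_le0 t : t *: u <= 0 -> t <= 0.
Proof.
move=> h; rewrite leNgt; apply/negP => t0; apply: u_neq0.
by apply: (scale_leK t0); rewrite scaler0.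
Qed.

Let has_inf_pu x : has_inf [set t | x <= t *: u].
Proof.
split; first by have [n hn] := le_unit x; exists n%:R; rewrite /= scaler_nat.
have [n hn] := le_unit (- x); exists (- n%:R) => t /= xt.
rewrite -subr_le0; apply: scaleu_le0.
rewrite scalerBl scaleNr scaler_nat -(leD2r (t *: u)) subrK add0r.
apply: le_trans xt.
by rewrite -(leD2r (u *+ n - x)) addrA addNr add0r addrCA subrr addr0.
Qed.

Let pu_lt x t : pu u x < t -> x <= t *: u.
Proof.
move=> h; have e0 : 0 < t - pu u x by rewrite subr_gt0.
have [s /= xs st] := inf_adherent e0 (has_inf_pu x).
apply: le_trans xs _; apply: scale_le; apply: ltW.
by rewrite /pu subrKC in st.
Qed.

Let pu_le x t : x <= t *: u -> pu u x <= t.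
Proof. by move=> h; apply: ge_inf => //; case: (has_inf_pu x). Qed.

Let pu_le0 x : pu u x <= 0 -> x <= 0.
Proof.
move=> px; apply: (archE (x := u)) => -[|n]; first by rewrite mulr0n u_unit.1.
have n0 : 0 < n.+1%:R^-1 :> R by rewrite invr_gt0.
apply: (scale_leK n0); rewrite -scaler_nat scalerA mulVf ?pnatr_eq0// scale1r.
by apply: pu_lt; exact: le_lt_trans n0.
Qed.

Let pu0 x : x = 0 -> pu u x <= 0.
Proof. by move=> ->; apply: pu_le; rewrite scale0r. Qed.

Let puD x y : pu u (x + y) <= pu u x + pu u y.
Proof.
apply/ler_addgt0Pr => e e0; have e2 : 0 < e / 2 by rewrite divr_gt0.
apply: pu_le; have -> : pu u x + pu u y + e =
  (pu u x + e / 2) + (pu u y + e / 2) by rewrite addrACA -splitr.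
by rewrite scalerDl; apply: leD; apply: pu_lt; rewrite ltrDl.
Qed.

Lemma Dhuxx x : Dhu u x x = 0.
Proof. by rewrite /Dhu (max_l (pu0 (subrr x))) addr0. Qed.

Lemma Dhu_positivity x y : Dhu u x y = 0 -> x = y.
Proof.
move/eqP; rewrite /Dhu paddr_eq0 ?le_max ?lexx//.
have le0 z : Num.max 0 (pu u z) == 0 -> z <= 0.
  by move=> /eqP h; apply: pu_le0; rewrite -h le_max lexx orbT.
case/andP => /le0 xy /le0 yx; apply: le_anti.
by rewrite -(leD2r (- y)) -(leD2r (- x) y) !subrr xy yx.
Qed.

Lemma Dhu_sym x y : Dhu u x y = Dhu u y x.
Proof. exact: addrC. Qed.

Lemma Dhu_triangle y x z : Dhu u x z <= Dhu u x y + Dhu u y z.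
Proof.
have tri x' y' z' : Num.max 0 (pu u (x' - z')) <=
    Num.max 0 (pu u (x' - y')) + Num.max 0 (pu u (y' - z')).
  rewrite ge_max addr_ge0 ?le_max ?lexx//=.
  rewrite -(subrKA y' x'); apply: le_trans (puD _ _) _.
  by apply: lerD; rewrite le_max lexx orbT.
rewrite /Dhu addrACA; apply: lerD; first exact: tri.
by rewrite [leRHS]addrC; exact: tri.
Qed.

Definition Dhu_metricType : metricType R :=
  HB.pack (Riesz.sort E)
    (isMetric.Build R E Dhuxx Dhu_positivity Dhu_sym Dhu_triangle).

Lemma mdist_DhuE (x y : Dhu_metricType) : mdist x y = Dhu u x y.
Proof. by []. Qed.

End DhuMetric.

(* Main.v *)
Require Import Defs.
From HB Require Import structures.
From mathcomp Require Import all_boot all_order all_algebra.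
From mathcomp Require Import all_classical all_reals.
From mathcomp Require Import topology.
From mathcomp Require Import lra.

(** Write [beta x y] for [max 0 (p_u (x - y))], the least [t >= 0] such that
    [x <= y + t u]; that this least [t] exists is where the Archimedean
    property enters ([pu_le], [betau_le]). Both the distance and the parameter
    interval are expressed by it:
    [Dhu x y = beta x y + beta y x] and [alpha x y = - beta y x]
    ([alphauE]), so the interval [[alpha x y, beta x y]] has length exactly
    [Dhu x y].

    Following [gamma] from [x1] to [x2], one first raises [x2 + t u] inside
    [x1 \/ (x2 + t u)] until [t = 0], and then lowers [x1 - t u] inside
    [(x1 - t u) \/ x2]. Translating one term of a join by [(t - s) u] changes
    the join by an element between [0] and [(t - s) u], so each half is
    1-Lipschitz ([Dhu_join_shift_le]), and by the triangle inequality at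
    [t = 0] so is the whole path ([Dhu_gammau_le]).

    No lower bound has to be computed: a 1-Lipschitz path whose parameter
    interval is no longer than the distance between its endpoints cannot lose
    length anywhere, so it is a geodesic ([lipschitz_geodesic]).

    For the image, a point of the segment whose parameter falls outside the
    interval is a join in which one of the terms [x1], [x2] absorbs the other
    one, so it is an endpoint ([max_plus_ray_sub_gammau]). *)

Set Implicit Arguments.
Unset Strict Implicit.
Unset Printing Implicit Defensive.

Import Order.TTheory GRing.Theory Num.Theory.

Local Open Scope classical_set_scope.
Local Open Scope ring_scope.

(** * Lipschitz paths in metric spaces *)

(** If some piece [[s, t]] were mapped to points at distance less than
    [t - s], going through it would bring [x2] closer than [b - a] to [x1]. *)
Lemma lipschitz_geodesic (R : realType) (X : metricType R) (x1 x2 : X)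
    (a b : R) (theta : R -> X) :
  a <= b -> theta a = x1 -> theta b = x2 ->
  (forall s t, s <= t -> mdist (theta s) (theta t) <= t - s) ->
  b - a <= mdist x1 x2 ->
  parametrized_geodesic x1 x2 a b theta.
Proof.
move=> ab thetaa thetab lip len; split=> // s t.
wlog st : s t / s <= t.
  move=> h; have [/h//|/ltW ts] := leP s t => sab tab.
  by rewrite metric_sym distrC h.
rewrite !in_itv/= => /andP[sa _] /andP[_ tb].
rewrite distrC ger0_norm ?subr_ge0//; apply: le_anti; rewrite lip//=.
have tri1 := metric_triangle (theta a) (theta s) (theta b).
have tri2 := metric_triangle (theta s) (theta t) (theta b).
have las := lip _ _ sa; have ltb := lip _ _ tb.
rewrite -thetaa -thetab in len; lra.
Qed.

(** * Riesz spaces *)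

Section RieszTheory.
Context {R : numDomainType} {E : rieszType R}.
Implicit Types x y z : E.

Lemma riesz_lerD2r z x y : (x + z <= y + z) = (x <= y).
Proof.
apply/idP/idP => [h|]; last exact: riesz_leD2r.
by rewrite -(addrK z x) -(addrK z y) riesz_leD2r.
Qed.

Lemma riesz_lerBlDl x y z : (x - y <= z) = (x <= y + z).
Proof. by rewrite -(riesz_lerD2r y (x - y)) subrK addrC. Qed.

Lemma riesz_lerN2 x y : (- x <= - y) = (y <= x).
Proof. by rewrite -(riesz_lerD2r (x + y) (- x)) addKr addrC addrK. Qed.

Lemma riesz_lerDl x z : (x <= x + z) = (0 <= z).
Proof. by rewrite -{1}(add0r x) [x + z]addrC riesz_lerD2r. Qed.

Lemma rjoin_ubl x y : x <= rjoin x y.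
Proof. by have := lexx (rjoin x y); rewrite riesz_leUx => /andP[]. Qed.

Lemma rjoin_ubr x y : y <= rjoin x y.
Proof. by have := lexx (rjoin x y); rewrite riesz_leUx => /andP[]. Qed.

Lemma rjoinC x y : rjoin x y = rjoin y x.
Proof. by rewrite !rjoinE joinC. Qed.

Lemma rjoin_idPr x y : x <= y -> rjoin x y = y.
Proof.
by move=> xy; apply: le_anti; rewrite riesz_leUx xy lexx rjoin_ubr.
Qed.

Lemma rjoin_mono x x' y y' : x <= x' -> y <= y' -> rjoin x y <= rjoin x' y'.
Proof.
move=> xx' yy'; rewrite riesz_leUx (le_trans xx' (rjoin_ubl _ _)).
exact: le_trans yy' (rjoin_ubr _ _).
Qed.

Lemma riesz_scale_ler (a b : R) x : 0 <= x -> a <= b -> a *: x <= b *: x.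
Proof.
move=> x0 ab; rewrite -(subrK a b) scalerDl addrC riesz_lerDl.
by apply: riesz_scale_ge0; rewrite ?subr_ge0.
Qed.

Lemma order_unit_bound u x : @order_unit R E u -> exists n : nat, x <= u *+ n.
Proof.
move=> [_ /(_ _ (rjoin_ubr x 0))[n hn]]; exists n.
exact: le_trans (rjoin_ubl x 0) hn.
Qed.

Lemma order_unit_not_le0 u :
  (exists x : E, x <> 0) -> @order_unit R E u -> ~ (u <= 0).
Proof.
move=> [x x0] uu u_le0; apply: x0.
have u0 : u = 0 by apply: le_anti; rewrite u_le0 uu.1.
have le0 y : y <= 0 by have [n] := order_unit_bound y uu; rewrite u0 mul0rn.
by apply: le_anti; rewrite le0 -riesz_lerN2 oppr0 le0.
Qed.

End RieszTheory.

Lemma riesz_scale_lerK (R : numFieldType) (E : rieszType R) (t : R) (x y : E) :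
  0 < t -> t *: x <= t *: y -> x <= y.
Proof.
move=> t0 h; rewrite -(subrKC x y) riesz_lerDl.
rewrite -[y - x](scalerK (lt0r_neq0 t0)) scalerBr.
apply: riesz_scale_ge0; first by rewrite invr_ge0 ltW.
by rewrite -(riesz_lerDl (t *: x)) subrKC.
Qed.

(** * The gauge of an order unit *)

Section Gauge.
Context {R : realType} {E : rieszType R}.
Implicit Types (u x y : E) (s t : R).

Lemma quE u x : qu u x = - pu u (- x).
Proof.
rewrite /qu /pu /inf opprK; congr sup.
apply/seteqP; split => [t /= tx|_ [t /= xt <-]].
  by exists (- t); rewrite ?opprK//= scaleNr riesz_lerN2.
by rewrite -riesz_lerN2 scaleNr opprK.
Qed.

Lemma alphauE u x y : alphau u x y = - betau u y x.
Proof. by rewrite /alphau quE opprB /betau oppr_max oppr0. Qed.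

(** Exchanging the endpoints reverses the path; this is what reduces every
    statement about parameters [t <= 0] to parameters [t >= 0]. *)
Lemma gammau_opp u x y t : gammau u x y (- t) = gammau u y x t.
Proof.
rewrite /gammau oppr_le0 scaleNr opprK.
case: (ltgtP t 0) => [_|_|->]; [exact: rjoinC|exact: rjoinC|].
by rewrite scale0r subr0 addr0 rjoinC.
Qed.

Lemma gammau_ge0 u x y t : 0 <= t -> gammau u x y t = rjoin (x - t *: u) y.
Proof.
move=> t0; rewrite -(gammau_opp u y x) /gammau oppr_le0 t0.
by rewrite scaleNr rjoinC.
Qed.

End Gauge.

Section ArchimedeanUnit.
Context {R : realType} {E : rieszType R}.
Hypothesis E_neq0 : exists x : E, x <> 0.
Hypothesis archE : riesz_archimedean E.
Context {u : E}.
Hypothesis u_unit : order_unit u.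
Implicit Types (x y z : E) (s t : R).

Let u_ge0 : 0 <= u := u_unit.1.

Lemma has_inf_gauge x : has_inf [set t | x <= t *: u].
Proof.
split; first by have [n] := order_unit_bound x u_unit; exists n%:R;
  rewrite /= scaler_nat.
have [n hn] := order_unit_bound (- x) u_unit; exists (- n%:R) => t /= xt.
(* Otherwise [0 = x - x <= (t + n) u] with [t + n < 0], so [u <= 0]. *)
rewrite leNgt; apply/negP => tn; apply: (order_unit_not_le0 E_neq0 u_unit).
have c0 : 0 < - n%:R - t by rewrite subr_gt0.
apply: (riesz_scale_lerK c0).
rewrite scaler0 scalerBl scaleNr scaler_nat riesz_lerBlDl addr0.
by apply: le_trans xt; rewrite -riesz_lerN2 opprK.
Qed.

(** The infimum defining [pu u x] is attained: [x - (pu u x) u] is below every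
    positive multiple of [u], hence nonpositive by the Archimedean property. *)
Lemma pu_le x t : (pu u x <= t) = (x <= t *: u).
Proof.
apply/idP/idP => [pt|xt]; last by apply: ge_inf => //; case: (has_inf_gauge x).
suff : x - t *: u <= 0 by rewrite riesz_lerBlDl addr0.
apply: (archE (x := u)) => -[|n]; first by rewrite mulr0n.
have n0 : 0 < n.+1%:R^-1 :> R by rewrite invr_gt0.
apply: (riesz_scale_lerK n0).
rewrite -scaler_nat scalerK ?pnatr_eq0// riesz_lerBlDl -scalerDl.
have [s /= xs st] := inf_adherent n0 (has_inf_gauge x).
apply: le_trans xs _; apply: riesz_scale_ler => //.
by apply: ltW; apply: lt_le_trans st _; rewrite lerD2r.
Qed.

Lemma betau_le x y t : (betau u x y <= t) = (0 <= t) && (x <= y + t *: u).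
Proof. by rewrite /betau ge_max pu_le riesz_lerBlDl. Qed.

Lemma betau_ge0 x y : 0 <= betau u x y.
Proof. by rewrite /betau le_max lexx. Qed.

Lemma le_add_betau x y : x <= y + betau u x y *: u.
Proof. by have := lexx (betau u x y); rewrite betau_le => /andP[]. Qed.

(** * The max-plus geodesics *)

Lemma Dhu_join_shift_le x y s t :
  s <= t -> Dhu u (rjoin (x + s *: u) y) (rjoin (x + t *: u) y) <= t - s.
Proof.
move=> st; have ts0 : 0 <= t - s by rewrite subr_ge0.
rewrite -[leRHS]add0r; apply: lerD.
  rewrite -/(betau u _ _) betau_le lexx scale0r addr0.
  by apply: rjoin_mono => //; rewrite ![x + _]addrC riesz_lerD2r riesz_scale_ler.
rewrite -/(betau u _ _) betau_le ts0 riesz_leUx/=; apply/andP; split.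
  rewrite -{1}(subrKC s t) scalerDl addrA riesz_lerD2r.
  exact: rjoin_ubl.
apply: le_trans (rjoin_ubr (x + s *: u) y) _.
by rewrite riesz_lerDl riesz_scale_ge0.
Qed.

Lemma Dhu_gammau_le x1 x2 s t :
  s <= t -> Dhu u (gammau u x1 x2 s) (gammau u x1 x2 t) <= t - s.
Proof.
have nonneg y1 y2 (a b : R) : 0 <= a -> a <= b ->
    Dhu u (gammau u y1 y2 a) (gammau u y1 y2 b) <= b - a.
  move=> a0 ab; rewrite !gammau_ge0 ?(le_trans a0 ab)// -!scaleNr Dhu_sym.
  have -> : b - a = - a - - b by rewrite opprK addrC.
  by apply: Dhu_join_shift_le; rewrite lerN2.
have nonpos (a b : R) : b <= 0 -> a <= b ->
    Dhu u (gammau u x1 x2 a) (gammau u x1 x2 b) <= b - a.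
  move=> b0 ab; rewrite -!(gammau_opp u x2 x1) Dhu_sym.
  have -> : b - a = - a - - b by rewrite opprK addrC.
  by apply: nonneg; rewrite ?oppr_ge0 ?lerN2.
move=> st; have [t0|t0] := leP t 0; first exact: nonpos.
have [s0|s0] := leP 0 s; first exact: nonneg.
apply: le_trans (Dhu_triangle E_neq0 u_unit (gammau u x1 x2 0) _ _) _.
have -> : t - s = (0 - s) + (t - 0) by rewrite sub0r subr0 addrC.
by apply: lerD; [exact/nonpos/ltW|exact/nonneg/ltW].
Qed.

Lemma gammau_betau x1 x2 : gammau u x1 x2 (betau u x1 x2) = x2.
Proof.
rewrite gammau_ge0 ?betau_ge0//; apply: rjoin_idPr.
by rewrite riesz_lerBlDl addrC le_add_betau.
Qed.

Lemma gammau_alphau x1 x2 : gammau u x1 x2 (alphau u x1 x2) = x1.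
Proof. by rewrite alphauE gammau_opp gammau_betau. Qed.

Lemma alphau_le_betau x1 x2 : alphau u x1 x2 <= betau u x1 x2.
Proof.
by rewrite alphauE (le_trans _ (betau_ge0 x1 x2))// oppr_le0 betau_ge0.
Qed.

(** Once [- t] exceeds [betau u x1 x2], the term [x1 + t u] is absorbed by
    [x2], so beyond that parameter the ray stays at the endpoint [x2]. *)
Lemma max_plus_ray_sub_gammau x1 x2 t : t <= 0 ->
  exists2 s, 0 <= s <= betau u x1 x2 & gammau u x1 x2 s = rjoin (x1 + t *: u) x2.
Proof.
move=> t0; have Nt0 : 0 <= - t by rewrite oppr_ge0.
have [tb|bt] := leP (- t) (betau u x1 x2).
  by exists (- t); rewrite ?Nt0// gammau_ge0// scaleNr opprK.
exists (betau u x1 x2); first by rewrite betau_ge0 lexx.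
rewrite gammau_betau rjoin_idPr// -[t]opprK scaleNr riesz_lerBlDl addrC.
by have := ltW bt; rewrite betau_le => /andP[].
Qed.

Lemma image_gammau x1 x2 :
  gammau u x1 x2 @` `[alphau u x1 x2, betau u x1 x2] = max_plus_segment u x1 x2.
Proof.
apply/seteqP; split => [_ [t _ <-]|z].
  have [t0|t0] := leP t 0; first by left; exists t; rewrite // /gammau t0.
  right; exists (- t); first by rewrite /= oppr_le0 ltW.
  by rewrite gammau_ge0 ?ltW// scaleNr.
case=> -[t /= t0 <-]; last first.
  have [s /andP[s0 sb] <-] := max_plus_ray_sub_gammau x1 x2 t0.
  exists s => //=; rewrite in_itv/= sb andbT alphauE.
  by rewrite (le_trans _ s0)// oppr_le0 betau_ge0.
have [s /andP[s0 sb] h] := max_plus_ray_sub_gammau x2 x1 t0.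
exists (- s); last by rewrite gammau_opp h rjoinC.
rewrite /= in_itv/= alphauE lerN2 sb/=.
by rewrite (le_trans _ (betau_ge0 x1 x2))// oppr_le0.
Qed.

End ArchimedeanUnit.

Theorem theorem2 (R : realType) (E : rieszType R)
    (E_neq0 : exists x : E, x <> 0) (archE : riesz_archimedean E)
    (u : E) (u_unit : order_unit u) :
  [/\ forall (x1 x2 : E) (t1 t2 : R),
        t1 \in `[alphau u x1 x2, betau u x1 x2] ->
        t2 \in `[alphau u x1 x2, betau u x1 x2] ->
        Dhu u (gammau u x1 x2 t1) (gammau u x1 x2 t2) = `|t1 - t2|,
      @geodesic_structure R (Dhu_metricType E_neq0 archE u_unit)
        (alphau u) (betau u) (gammau u)
    & forall x1 x2 : E,
        gammau u x1 x2 @` `[alphau u x1 x2, betau u x1 x2] =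
        max_plus_segment u x1 x2].
Proof.
have geo : geodesic_structure (X := Dhu_metricType E_neq0 archE u_unit)
    (alphau u) (betau u) (gammau u).
  move=> x1 x2; apply: lipschitz_geodesic.
  - exact: alphau_le_betau.
  - exact: gammau_alphau.
  - exact: gammau_betau.
  - by move=> s t; rewrite mdist_DhuE; exact: Dhu_gammau_le.
  - by rewrite mdist_DhuE alphauE opprK.
split=> // [x1 x2|x1 x2]; last exact: image_gammau.
by have [_ _ _] := geo x1 x2.
Qed.
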